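(* Let $\{\mathcal G_k\}_{k=1}^\infty$ be a wide sequence and let $F$ be any family of random variables on $\mathcal G_n$. Let $\varphi(x_0,\dots,x_{l-1})$ be an open (quantifier-free) $\{E\}$-formula and assume that $$\lim_{k\to\infty}\Pr_{\omega\in\mathcal G_k}\big[\omega\models(\forall \overline x)\varphi(\overline x)\big]=1,$$ where $\omega$ is sampled uniformly from $\mathcal G_k$. Then, in the wide limit, $\lim_F\mathcal G_n[\![(\forall\overline x)\varphi(\overline x)]\!]=\mathbf 1$.
   Context: Setup. $L_{all}$ is the first-order language with a name for every relation and function on $\mathbb N$. Fix an $\aleph_1$-saturated nonstandard model $\mathcal M$ of the true theory $\mathrm{Th}_{L_{all}}(\mathbb N)$, with $\mathbb N\subseteq\mathcal M$ as an initial segment, and a nonstandard number $n\in\mathcal M\setminus\mathbb N$. Finite sets, functions and sequences are coded by numbers; for a set $S$ coded in $\mathcal M$, $|S|\in\mathcal M$ is its (possibly nonstandard) cardinality. Any sequence of standard finite objects $\{a_k\}_k$ is given by a function symbol of $L_{all}$ and hence has a value $a_n\in\mathcal M$ at the nonstandard index $n$. $\mathbb Q^{\mathcal M}$ is the ordered field of fractions of elements of $\mathcal M$ and their negatives; $\mathrm{st}(q)\in\mathbb R$ is the standard part of a finite $q\in\mathbb Q^{\mathcal M}$; $q$ is infinitesimal if $|q|<1/k$ for all standard $k\ge1$. Wide sequence. A sequence $\{\mathcal G_k\}_{k=1}^\infty$ of finite sets of graphs (structures with one antireflexive symmetric binary relation $E$) such that every $\omega\in\mathcal G_k$ has vertex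 set $\{0,\dots,k-1\}$ and $\lim_{k\to\infty}|\mathcal G_k|=\infty$. $\mathcal G_n$ is the value of the sequence at index $n$; for $\omega\in\mathcal G_n$, $E_\omega$ is its edge relation. Boolean algebra. $\mathcal A$ is the Boolean algebra of all subsets of $\mathcal G_n$ coded by an element of $\mathcal M$; $\mathcal I$ is the ideal of those $A\in\mathcal A$ with $|A|/|\mathcal G_n|$ infinitesimal; $\mathcal B=\mathcal A/\mathcal I$. $\mathcal B$ is a complete Boolean algebra with greatest element $\mathbf 1$, least element $\mathbf 0$, and measure $\mu(A/\mathcal I)=\mathrm{st}(|A|/|\mathcal G_n|)$. Family of random variables. A set $F$ of functions $\alpha:\mathcal G_n\to\mathcal M$, each coded by an element of $\mathcal M$. An $F$-vertex is an $\alpha\in F$ with $\alpha(\omega)\in\{0,\dots,n-1\}$ for all $\omega\in\mathcal G_n$; $U(F)$ is the set of $F$-vertices. Wide limit. $\lim_F\mathcal G_n$ is the $\mathcal B$-valued $\{E\}$-structure with universe $U(F)$ and truth values $[\![\alpha=\beta]\!]=\{\omega\in\mathcal G_n:\alpha(\omega)=\beta(\omega)\}/\mathcal I$, $[\![E(\alpha,\beta)]\!]=\{\omega\in\mathcal G_n:E_\omega(\alpha(\omega),\beta(\omega))\}/\mathcal I$; $[\![-]\!]$ commutes with $\neg,\wedge,\vee$; $[\![(\exists x)A(x)]\!]=\bigvee_{\alpha\in U(F)}[\![A(\alpha)]\!]$ and $[\![(\forall x)A(x)]\!]=\bigwedge_{\alpha\in U(F)}[\![A(\alpha)]\!]$.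 *)

(* Defs.v *)
From HB Require Import structures.
From mathcomp Require Import all_boot all_order all_algebra.
From mathcomp Require Import finmap generic_quotient.
From mathcomp Require Import all_classical all_reals all_analysis.
From mathcomp Require Import zify choice.

Set Implicit Arguments.
Unset Strict Implicit.
Unset Printing Implicit Defensive.

Import Order.TTheory GRing.Theory Num.Theory.

Local Open Scope classical_set_scope.
Local Open Scope quotient_scope.

(** Formulas are well-scoped: a formula of index [m] has its free variables
    among [x_0, ..., x_(m-1)], and a quantifier in front of a formula of index
    [m.+1] binds [x_m].  An assignment is a map ['I_m -> T]. *)

Definition noassign {T : Type} : 'I_0 -> T :=
  fun i => False_rect T (notF (ltn_ord i)).

Definition snoc {T : Type} {m : nat} (v : 'I_m -> T) (x : T) : 'I_m.+1 -> T :=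
  fun i => oapp v x (unlift ord_max i).

Lemma snocK (T : Type) m (v : 'I_m.+1 -> T) :
  snoc (fun i => v (lift ord_max i)) (v ord_max) = v.
Proof. by apply/funext => i; rewrite /snoc; case: unliftP => [j ->|->]. Qed.

Lemma noassignE (T : Type) (v : 'I_0 -> T) : v = noassign.
Proof. by apply/funext; case. Qed.

(** The [k]-ary function (relation) symbols of [L_all] are the [k]-ary functions
    (relations) on [nat] themselves. *)

Inductive Lterm (m : nat) : Type :=
| LVar of 'I_m
| LFun (k : nat) of (('I_k -> nat) -> nat) & ('I_k -> Lterm m).

Inductive Lform : nat -> Type :=
| LEq m of Lterm m & Lterm m : Lform m
| LRel m (k : nat) of (('I_k -> nat) -> Prop) & ('I_k -> Lterm m) : Lform m
| LNot m of Lform m : Lform m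
| LAnd m of Lform m & Lform m : Lform m
| LOr m of Lform m & Lform m : Lform m
| LImp m of Lform m & Lform m : Lform m
| LEx m of Lform m.+1 : Lform m
| LAll m of Lform m.+1 : Lform m.

Record Lstructure := {
  carrier :> Type;
  fun_of : forall k : nat, (('I_k -> nat) -> nat) -> ('I_k -> carrier) -> carrier;
  rel_of : forall k : nat, (('I_k -> nat) -> Prop) -> ('I_k -> carrier) -> Prop
}.

Fixpoint Leval (M : Lstructure) m (t : Lterm m) (v : 'I_m -> M) : M :=
  match t with
  | LVar i => v i
  | LFun k f ts => fun_of f (fun i => Leval (ts i) v)
  end.

Fixpoint Lsat (M : Lstructure) m (phi : Lform m) : ('I_m -> M) -> Prop :=
  match phi with
  | LEq _ s t => fun v => Leval s v = Leval t v
  | LRel _ k R ts => fun v => rel_of R (fun i => Leval (ts i) v)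
  | LNot _ p => fun v => ~ Lsat p v
  | LAnd _ p q => fun v => Lsat p v /\ Lsat q v
  | LOr _ p q => fun v => Lsat p v \/ Lsat q v
  | LImp _ p q => fun v => Lsat p v -> Lsat q v
  | LEx _ p => fun v => exists x : M, Lsat p (snoc v x)
  | LAll _ p => fun v => forall x : M, Lsat p (snoc v x)
  end.

Definition NN : Lstructure :=
  {| carrier := nat; fun_of := fun k f v => f v; rel_of := fun k R v => R v |}.

Record trueModel := {
  model_struct :> Lstructure;
  model_true : forall phi : Lform 0,
    Lsat (M := NN) phi noassign -> Lsat (M := model_struct) phi noassign
}.

Record pform (M : Lstructure) := {
  parity : nat;
  pbody : Lform parity.+1;
  params : 'I_parity -> M
}.

Definition psat (M : Lstructure) (x : M) (psi : pform M) : Prop :=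
  Lsat (pbody psi) (snoc (@params M psi) x).

(** Only the parameter set is countable: [L_all] is uncountable, so the type
    itself may be uncountable. *)
Definition aleph1_saturated (M : Lstructure) : Prop :=
  forall (A : set M) (p : set (pform M)),
    countable A ->
    (forall psi, p psi -> range (@params M psi) `<=` A) ->
    (forall q, finite_set q -> q `<=` p ->
       exists x : M, forall psi, q psi -> psat x psi) ->
    exists x : M, forall psi, p psi -> psat x psi.

Fixpoint Lclosure m : Lform m -> Lform 0 :=
  match m return Lform m -> Lform 0 with
  | 0 => fun phi => phi
  | m'.+1 => fun phi => Lclosure (LAll phi)
  end.

Lemma Lsat_closure (M : Lstructure) m (phi : Lform m) :
  Lsat (M := M) (Lclosure phi) noassign <-> forall v, Lsat (M := M) phi v.
Proof.
elim: m phi => [|m IH] phi /=.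
  by split=> [h v|h]; [rewrite (noassignE v) | apply: h].
rewrite IH /=; split=> [h v|h v x]; last exact: h.
by rewrite -(snocK v); apply: h.
Qed.

Lemma transfer (M : trueModel) m (phi : Lform m) :
  (forall v, Lsat (M := NN) phi v) -> forall v, Lsat (M := M) phi v.
Proof. by move=> /Lsat_closure/(model_true M)/Lsat_closure. Qed.

Definition row (T : Type) k (x : T) (s : seq T) : 'I_k -> T :=
  fun i => nth x (x :: s) i.

Lemma row_map (T U : Type) (g : T -> U) k x s :
  (fun i : 'I_k => g (row x s i)) = row (g x) (map g s).
Proof.
apply/funext => i; rewrite /row /= -[g x :: _]/(map g (x :: s)).
by elim: (x :: s) (nat_of_ord i) => [|a l IH] [|j] //=; apply: IH.
Qed.

Definition sym0 (c : nat) : ('I_0 -> nat) -> nat := fun _ => c.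
Definition sym1 (f : nat -> nat) : ('I_1 -> nat) -> nat := fun v => f (v ord0).
Definition sym2 (T : Type) (f : nat -> nat -> T) : ('I_2 -> nat) -> T :=
  fun v => f (v (@Ordinal 2 0 isT)) (v (@Ordinal 2 1 isT)).
Definition sym3 (f : nat -> nat -> nat -> nat) : ('I_3 -> nat) -> nat :=
  fun v => f (v (@Ordinal 3 0 isT)) (v (@Ordinal 3 1 isT)) (v (@Ordinal 3 2 isT)).

Section Interp.
Variable M : Lstructure.
Definition std (c : nat) : M := fun_of (sym0 c) noassign.
Definition fun1 (f : nat -> nat) (x : M) : M := fun_of (sym1 f) (row x [::]).
Definition fun2 (f : nat -> nat -> nat) (x y : M) : M :=
  fun_of (sym2 f) (row x [:: y]).
Definition fun3 (f : nat -> nat -> nat -> nat) (x y z : M) : M :=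
  fun_of (sym3 f) (row x [:: y; z]).
Definition rel2 (R : nat -> nat -> Prop) (x y : M) : Prop :=
  rel_of (sym2 R) (row x [:: y]).
End Interp.

Definition T0 m c : Lterm m := LFun (sym0 c) noassign.
Definition T1 m f (x : Lterm m) := LFun (sym1 f) (row x [::]).
Definition T2 m f (x y : Lterm m) := LFun (sym2 f) (row x [:: y]).
Definition T3 m f (x y z : Lterm m) := LFun (sym3 f) (row x [:: y; z]).
Definition R2 m R (x y : Lterm m) := LRel (sym2 R) (row x [:: y]).
Definition LIff m (p q : Lform m) := LAnd (LImp p q) (LImp q p).

Lemma T0E (M : Lstructure) m c (v : 'I_m -> M) : Leval (T0 m c) v = std M c.
Proof. by rewrite /= [X in fun_of _ X]noassignE. Qed.
Lemma T1E (M : Lstructure) m f x (v : 'I_m -> M) :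
  Leval (T1 f x) v = fun1 f (Leval x v).
Proof. by rewrite /= (row_map (fun t => Leval t v)). Qed.
Lemma T2E (M : Lstructure) m f x y (v : 'I_m -> M) :
  Leval (T2 f x y) v = fun2 f (Leval x v) (Leval y v).
Proof. by rewrite /= (row_map (fun t => Leval t v)). Qed.
Lemma T3E (M : Lstructure) m f x y z (v : 'I_m -> M) :
  Leval (T3 f x y z) v = fun3 f (Leval x v) (Leval y v) (Leval z v).
Proof. by rewrite /= (row_map (fun t => Leval t v)). Qed.
Lemma R2E (M : Lstructure) m R x y (v : 'I_m -> M) :
  Lsat (R2 R x y) v = rel2 R (Leval x v) (Leval y v).
Proof. by rewrite /= (row_map (fun t => Leval t v)). Qed.
Lemma VarE (M : Lstructure) m i (v : 'I_m -> M) : Leval (LVar i) v = v i.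
Proof. by []. Qed.
Lemma EqE (M : Lstructure) m s t (v : 'I_m -> M) :
  Lsat (LEq s t) v = (Leval s v = Leval t v).
Proof. by []. Qed.
Lemma NotE (M : Lstructure) m p (v : 'I_m -> M) :
  Lsat (LNot p) v = (~ Lsat p v).
Proof. by []. Qed.
Lemma AndE (M : Lstructure) m p q (v : 'I_m -> M) :
  Lsat (LAnd p q) v = (Lsat p v /\ Lsat q v).
Proof. by []. Qed.
Lemma OrE (M : Lstructure) m p q (v : 'I_m -> M) :
  Lsat (LOr p q) v = (Lsat p v \/ Lsat q v).
Proof. by []. Qed.
Lemma ImpE (M : Lstructure) m p q (v : 'I_m -> M) :
  Lsat (LImp p q) v = (Lsat p v -> Lsat q v).
Proof. by []. Qed.
Lemma IffE (M : Lstructure) m p q (v : 'I_m -> M) :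
  Lsat (LIff p q) v = (Lsat p v <-> Lsat q v).
Proof. by []. Qed.
Definition LE :=
  (T0E, T1E, T2E, T3E, R2E, VarE, EqE, NotE, AndE, OrE, ImpE, IffE).
#[local] Arguments Leval : simpl never.
#[local] Arguments Lsat : simpl never.

(** Finite sets of numbers and pairs of numbers are coded by MathComp's
    [pickle].  Numbers that are not of the form [pickle A] are read as codes of
    some finite set too, so a set may have several codes; nothing below depends
    on the choice of a code. *)

Definition decode (s : nat) : {fset nat} := odflt fset0%fset (unpickle s).
Definition encode (A : {fset nat}) : nat := pickle A.
Definition npair (x y : nat) : nat := pickle (x, y).
Definition nmem (x s : nat) : Prop := x \in decode s.
Definition ncard (s : nat) : nat := #|` decode s|%fset.
Definition nlt (x y : nat) : Prop := (x < y)%N.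

Lemma encodeK : cancel encode decode.
Proof. by move=> A; rewrite /decode /encode pickleK. Qed.

Section Coding.
Variable M : Lstructure.
Definition Mmem (x s : M) : Prop := rel2 nmem x s.
Definition Mlt (x y : M) : Prop := rel2 nlt x y.
Definition Mmul (x y : M) : M := fun2 muln x y.
Definition Mpair (x y : M) : M := fun2 npair x y.
Definition Medge (w x y : M) : Prop := Mmem (Mpair x y) w.
Definition Mcard (s : M) : M := fun1 ncard s.

Definition ext (s : M) : set M := [set x | Mmem x s].

(** The fraction [a / b], for [a], [b] in [M], is infinitesimal: [a / b < 1 / k]
    for all standard [k >= 1], the order of fractions being given by
    cross-multiplication.  As in MathComp, [a / 0] is [0]. *)
Definition infinitesimal (a b : M) : Prop :=
  forall k : nat, (1 <= k)%N -> Mlt (std M 0) b -> Mlt (Mmul (std M k) a) b.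

Variable g : M.

Definition codes (c : M) (X : set (ext g)) : Prop := val @` X = ext c.
Definition coded (X : set (ext g)) : Prop := exists c : M, codes c X.
Definition coded_fun (alpha : ext g -> M) : Prop :=
  exists c : M, ext c = range (fun w : ext g => Mpair (val w) (alpha w)).
Definition negligible (X : set (ext g)) : Prop :=
  exists2 c : M, codes c X & infinitesimal (Mcard c) (Mcard g).
End Coding.

Lemma fun1N f x : fun1 (M := NN) f x = f x. Proof. by []. Qed.
Lemma fun2N f x y : fun2 (M := NN) f x y = f x y. Proof. by []. Qed.
Lemma fun3N f x y z : fun3 (M := NN) f x y z = f x y z. Proof. by []. Qed.
Lemma rel2N R x y : rel2 (M := NN) R x y = R x y. Proof. by []. Qed.
Lemma stdN k : std NN k = k. Proof. by []. Qed.
Definition NNE := (fun1N, fun2N, fun3N, rel2N, stdN).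

Definition ndiff (c d : nat) : nat := encode (decode c `\` decode d)%fset.
Definition nunion (c d : nat) : nat := encode (decode c `|` decode d)%fset.
Definition nwit (c d : nat) : nat := xget 0 [set x | nmem x c /\ ~ nmem x d].
Definition napp (c x : nat) : nat := xget 0 [set y | nmem (npair x y) c].
Definition nsep (P : nat -> nat -> nat -> Prop) (g c d : nat) : nat :=
  encode [fset x in decode g | `[< P x (napp c x) (napp d x) >]]%fset.

Section Transferred.
Variable M : trueModel.
Implicit Types x y z c d : M.

Local Notation v3 i := (LVar (@Ordinal 3 i isT)).
Local Notation v4 i := (LVar (@Ordinal 4 i isT)).

Lemma Mmem_diff x c d : Mmem x (fun2 ndiff c d) <-> Mmem x c /\ ~ Mmem x d.
Proof.
have := @transfer M 3 (LIff (R2 nmem (v3 0) (T2 ndiff (v3 1) (v3 2)))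
  (LAnd (R2 nmem (v3 0) (v3 1)) (LNot (R2 nmem (v3 0) (v3 2))))).
move=> tr; have {tr} := fun H => tr H (row x [:: c; d]); rewrite !LE /=; apply=> v.
rewrite !LE !NNE /nmem encodeK in_fsetD andbC.
by split=> [/andP[-> /negP]|[-> /negP]].
Qed.

Lemma Mmem_union x c d : Mmem x (fun2 nunion c d) <-> Mmem x c \/ Mmem x d.
Proof.
have := @transfer M 3 (LIff (R2 nmem (v3 0) (T2 nunion (v3 1) (v3 2)))
  (LOr (R2 nmem (v3 0) (v3 1)) (R2 nmem (v3 0) (v3 2)))).
move=> tr; have {tr} := fun H => tr H (row x [:: c; d]).
rewrite !LE /=; apply=> v; rewrite !LE !NNE.
rewrite /nmem encodeK in_fsetU.
by split=> [/orP[]|[]] ->; rewrite ?orbT; [left|right| |].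
Qed.

Lemma Mpair_inj x y x' y' : Mpair x y = Mpair x' y' -> x = x' /\ y = y'.
Proof.
have := @transfer M 4 (LImp
  (LEq (T2 npair (v4 0) (v4 1)) (T2 npair (v4 2) (v4 3)))
  (LAnd (LEq (v4 0) (v4 2)) (LEq (v4 1) (v4 3)))).
move=> tr; have {tr} := fun H => tr H (row x [:: y; x'; y']); rewrite !LE /=; apply=> v.
by rewrite !LE !NNE => /(pcan_inj pickleK)[].
Qed.

Lemma Mapp_mem c x y :
  Mmem (Mpair x y) c -> Mmem (Mpair x (fun2 napp c x)) c.
Proof.
have := @transfer M 3 (LImp
  (R2 nmem (T2 npair (v3 1) (v3 2)) (v3 0))
  (R2 nmem (T2 npair (v3 1) (T2 napp (v3 0) (v3 1))) (v3 0))).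
move=> tr; have {tr} := fun H => tr H (row c [:: x; y]); rewrite !LE /=; apply=> v.
rewrite !LE !NNE => h.
by rewrite /napp; case: xgetP => [z -> //|/(_ _ h)].
Qed.

Lemma Mmem_sep_eq x g c d :
  Mmem x (fun3 (nsep (fun _ a b => a = b)) g c d) <->
  Mmem x g /\ fun2 napp c x = fun2 napp d x.
Proof.
have := @transfer M 4 (LIff
  (R2 nmem (v4 0)
     (T3 (nsep (fun _ a b => a = b)) (v4 1) (v4 2) (v4 3)))
  (LAnd (R2 nmem (v4 0) (v4 1))
     (LEq (T2 napp (v4 2) (v4 0)) (T2 napp (v4 3) (v4 0))))).
move=> tr; have {tr} := fun H => tr H (row x [:: g; c; d]); rewrite !LE /=; apply=> v.
rewrite !LE !NNE /nmem encodeK !inE /=.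
by split=> [/andP[-> /asboolP]|[-> /asboolP]].
Qed.

Lemma Mmem_sep_edge x g c d :
  Mmem x (fun3 (nsep (fun w a b => nmem (npair a b) w)) g c d) <->
  Mmem x g /\ Mmem (Mpair (fun2 napp c x) (fun2 napp d x)) x.
Proof.
have := @transfer M 4 (LIff
  (R2 nmem (v4 0) (T3 (nsep (fun w a b => nmem (npair a b) w))
     (v4 1) (v4 2) (v4 3)))
  (LAnd (R2 nmem (v4 0) (v4 1))
     (R2 nmem (T2 npair (T2 napp (v4 2) (v4 0))
                        (T2 napp (v4 3) (v4 0))) (v4 0)))).
move=> tr; have {tr} := fun H => tr H (row x [:: g; c; d]); rewrite !LE /=; apply=> v.
rewrite !LE !NNE /nmem encodeK !inE /=.
by split=> [/andP[-> /asboolP]|[-> /asboolP]].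
Qed.

Lemma infinitesimal_sub c d b : ext c `<=` ext d ->
  infinitesimal (Mcard d) b -> infinitesimal (Mcard c) b.
Proof.
move=> cd h k k1 b0; have {h} := h k k1 b0.
have := @transfer M 4 (LImp
  (LImp (R2 nmem (T2 nwit (v4 0) (v4 1)) (v4 0))
        (R2 nmem (T2 nwit (v4 0) (v4 1)) (v4 1)))
  (LImp (R2 nlt (T2 muln (v4 3) (T1 ncard (v4 1))) (v4 2))
        (R2 nlt (T2 muln (v4 3) (T1 ncard (v4 0))) (v4 2)))).
move=> tr; have {tr} := fun H => tr H (row c [:: d; b; std M k]); rewrite !LE /=; apply; last exact: cd.
move=> v {cd}; rewrite !LE !NNE {k1 b0}.
move: (v (@Ordinal 4 0 isT)) (v (@Ordinal 4 1 isT)) => {}c {}d.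
move: (v (@Ordinal 4 2 isT)) (v (@Ordinal 4 3 isT)) => {}b {}k w.
apply: leq_ltn_trans; rewrite leq_mul2l; apply/orP; right.
apply/fsubset_leq_card/fsubsetP => y yc; apply: contrapT => yd.
have : nmem (nwit c d) c /\ ~ nmem (nwit c d) d.
  by rewrite /nwit; case: xgetP => [z -> //|/(_ y)/(_ (conj yc yd))].
by case=> /w.
Qed.

Lemma infinitesimal_union c d b : infinitesimal (Mcard c) b ->
  infinitesimal (Mcard d) b -> infinitesimal (Mcard (fun2 nunion c d)) b.
Proof.
move=> hc hd k k1 b0.
have k2 : (0 < k.*2)%N by rewrite double_gt0.
have dblE : std M k.*2 = fun1 double (std M k).
  have := @transfer M 0 (LEq (T0 _ k.*2) (T1 double (T0 _ k))).
  by move=> tr; have {tr} := fun H => tr H noassign; rewrite !LE; apply=> v; rewrite !LE.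
move: (hc _ k2 b0) (hd _ k2 b0); rewrite dblE.
have := @transfer M 4 (LImp
  (R2 nlt (T2 muln (T1 double (v4 3)) (T1 ncard (v4 0))) (v4 2))
  (LImp (R2 nlt (T2 muln (T1 double (v4 3)) (T1 ncard (v4 1))) (v4 2))
  (R2 nlt (T2 muln (v4 3) (T1 ncard (T2 nunion (v4 0) (v4 1))))
     (v4 2)))).
move=> tr; have {tr} := fun H => tr H (row c [:: d; b; std M k]); rewrite !LE /=; apply=> v.
rewrite !LE !NNE {hc hd k2 dblE k1 b0}.
move: (v (@Ordinal 4 0 isT)) (v (@Ordinal 4 1 isT)) => {}c {}d.
move: (v (@Ordinal 4 2 isT)) (v (@Ordinal 4 3 isT)) => {}b {}k.
rewrite /nlt /nunion /ncard encodeK => h1 h2.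
have : (#|` (decode c `|` decode d)%fset| <=
        #|` decode c|%fset + #|` decode d|%fset)%N.
  by rewrite cardfsU leq_subr.
by rewrite -(leq_pmul2l (isT : 0 < 2)%N); nia.
Qed.

Lemma infinitesimal_diff c b : infinitesimal (Mcard (fun2 ndiff c c)) b.
Proof.
move=> k _.
have := @transfer M 3 (LImp (R2 nlt (T0 _ 0) (v3 1))
  (R2 nlt (T2 muln (v3 2) (T1 ncard (T2 ndiff (v3 0) (v3 0))))
     (v3 1))).
move=> tr; have {tr} := fun H => tr H (row c [:: b; std M k]); rewrite !LE /=; apply=> v.
by rewrite !LE !NNE /nlt /ncard /ndiff encodeK fsetDv cardfs0 muln0.
Qed.

End Transferred.

Section CodedSets.
Variables (M : trueModel) (g : M).
Implicit Types X Y : set (ext g).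

Lemma codesP c X :
  codes c X <-> ext c `<=` ext g /\ forall w, X w <-> Mmem (val w) c.
Proof.
split=> [cX|[cg cX]].
  split=> [x|w]; first by rewrite -cX => -[w _ <-]; exact: set_valP.
  rewrite -[Mmem _ _]/(ext c (val w)) -cX; split=> [Xw|]; first by exists w.
  by case=> w' Xw' /val_inj <-.
apply/seteqP; split=> [x [w /cX ? <-] //|x xc].
by exists (SigSub (mem_set (cg _ xc))) => //; apply/cX.
Qed.

Lemma codedP c X : (forall w, X w <-> Mmem (val w) c) -> coded X.
Proof.
move=> cX; exists (fun2 ndiff g (fun2 ndiff g c)); apply/codesP; split.
  by move=> x /Mmem_diff[].
move=> w; have gw : Mmem (val w) g := set_valP w.
rewrite cX Mmem_diff; split=> [wc|[_ h]]; first by split=> // /Mmem_diff[].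
by apply: contrapT => wc; apply: h; apply/Mmem_diff.
Qed.

Lemma codedC X : coded X -> coded (~` X).
Proof.
case=> c /codesP[_ cX]; apply: (@codedP (fun2 ndiff g c)) => w.
rewrite Mmem_diff -cX; split=> [|[]//]; split=> //; exact: (set_valP w).
Qed.

Lemma codedU X Y : coded X -> coded Y -> coded (X `|` Y).
Proof.
case=> c /codesP[_ cX] [d /codesP[_ dY]].
by apply: (@codedP (fun2 nunion c d)) => w; rewrite Mmem_union -cX -dY.
Qed.

Lemma codedI X Y : coded X -> coded Y -> coded (X `&` Y).
Proof.
by move=> hX hY; rewrite -[X `&` Y]setCK setCI; apply/codedC/codedU; apply/codedC.
Qed.

Lemma coded0 : coded (set0 : set (ext g)).
Proof.
by apply: (@codedP (fun2 ndiff g g)) => w; rewrite Mmem_diff; split=> // -[].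
Qed.

Lemma codedT : coded [set: ext g].
Proof. by rewrite -setC0; apply/codedC/coded0. Qed.

Lemma negligible0 : negligible (set0 : set (ext g)).
Proof.
exists (fun2 ndiff g g); last exact: infinitesimal_diff.
by apply/codesP; split=> [x /Mmem_diff[]//|w]; rewrite Mmem_diff; split=> // -[].
Qed.

Lemma negligibleS X Y : coded X -> X `<=` Y -> negligible Y -> negligible X.
Proof.
move=> [c cX] XY [d dY h]; exists c => //.
by apply: infinitesimal_sub h; rewrite -cX -dY; apply: image_subset.
Qed.

Lemma negligibleU X Y : negligible X -> negligible Y -> negligible (X `|` Y).
Proof.
move=> [c /codesP[cg cX] hc] [d /codesP[dg dY] hd].
exists (fun2 nunion c d); last exact: infinitesimal_union.
apply/codesP; split=> [x /Mmem_union[/cg|/dg]//|w].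
by rewrite Mmem_union -cX -dY.
Qed.

Lemma coded_app (alpha : ext g -> M) : coded_fun alpha ->
  exists c : M, forall w, fun2 napp c (val w) = alpha w.
Proof.
case=> c cE; exists c => w.
have : ext c (Mpair (val w) (alpha w)) by rewrite cE; exists w.
move=> /Mapp_mem; rewrite -[Mmem _ _]/(ext c _) cE => -[w' _].
by move=> /Mpair_inj[/val_inj <- ->].
Qed.

Lemma coded_eq (alpha beta : ext g -> M) : coded_fun alpha -> coded_fun beta ->
  coded [set w | alpha w = beta w].
Proof.
move=> /coded_app[c cE] /coded_app[d dE].
apply: (@codedP (fun3 (nsep (fun _ a b => a = b)) g c d)) => w.
rewrite Mmem_sep_eq cE dE; split=> [|[]//].
by split=> //; exact: (set_valP w).
Qed.

Lemma coded_edge (alpha beta : ext g -> M) :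
  coded_fun alpha -> coded_fun beta ->
  coded [set w | Medge (val w) (alpha w) (beta w)].
Proof.
move=> /coded_app[c cE] /coded_app[d dE].
apply: (@codedP (fun3 (nsep (fun w a b => nmem (npair a b) w)) g c d)) => w.
rewrite Mmem_sep_edge cE dE /=; split=> [|[]//].
by split=> //; exact: (set_valP w).
Qed.

Definition alg : Type := {X : set (ext g) | `[< coded X >]}.
HB.instance Definition _ := Choice.on alg.

Definition Alg (X : set (ext g)) (h : coded X) : alg := exist _ X (asboolT h).

Lemma alg_coded (A : alg) : coded (val A).
Proof. exact: (asboolW (valP A)). Qed.

Definition algI (A B : alg) : alg := Alg (codedI (alg_coded A) (alg_coded B)).
Definition algU (A B : alg) : alg := Alg (codedU (alg_coded A) (alg_coded B)).
Definition algC (A : alg) : alg := Alg (codedC (alg_coded A)).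
Definition alg0 : alg := Alg coded0.
Definition algT : alg := Alg codedT.

Definition eq_mod (A B : alg) : bool := `[< negligible (val A `+` val B) >].

Lemma codedY X Y : coded X -> coded Y -> coded (X `+` Y).
Proof.
by move=> hX hY; rewrite /setY !setDE; apply: codedU; apply: codedI => //; apply: codedC.
Qed.

Lemma eq_mod_trans3 (A B C D E F : alg) :
  val A `+` val B `<=` (val C `+` val D) `|` (val E `+` val F) ->
  eq_mod C D -> eq_mod E F -> eq_mod A B.
Proof.
move=> h /asboolP cd /asboolP ef; apply/asboolP.
apply: negligibleS h (negligibleU cd ef).
by apply: codedY; apply: alg_coded.
Qed.

Lemma eq_mod_refl : reflexive eq_mod.
Proof. by move=> A; apply/asboolP; rewrite setYK; exact: negligible0. Qed.

Lemma eq_mod_sym : symmetric eq_mod.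
Proof. by move=> A B; rewrite /eq_mod setYC. Qed.


Lemma eq_mod_trans : transitive eq_mod.
Proof.
move=> B A C AB BC; apply: eq_mod_trans3 AB BC => w /=.
by have := EM (val B w); tauto.
Qed.

Canonical eq_mod_equiv := EquivRel eq_mod eq_mod_refl eq_mod_sym eq_mod_trans.

Definition balg : Type := {eq_quot eq_mod}.
HB.instance Definition _ := Choice.on balg.
HB.instance Definition _ := EqQuotient.on balg.

Lemma pi_eq_mod (A B : alg) : eq_mod A B -> \pi_balg A = \pi_balg B.
Proof. by move=> h; apply/eqmodP. Qed.

Definition balgI := lift_op2 balg algI.
Definition balgU := lift_op2 balg algU.
Definition balgC := lift_op1 balg algC.

Lemma eq_mod_repr (A : alg) : eq_mod (repr (\pi_balg A)) A.
Proof. by apply/eqmodP; rewrite reprK. Qed.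

Lemma pi_balgI : {morph \pi_balg : A B / algI A B >-> balgI A B}.
Proof.
move=> A B; unlock balgI; apply/esym/pi_eq_mod.
apply: eq_mod_trans3 (eq_mod_repr A) (eq_mod_repr B) => w /=.
have := EM (val A w); have := EM (val (repr (\pi_balg A)) w).
by have := EM (val B w); have := EM (val (repr (\pi_balg B)) w); tauto.
Qed.

Lemma pi_balgU : {morph \pi_balg : A B / algU A B >-> balgU A B}.
Proof.
move=> A B; unlock balgU; apply/esym/pi_eq_mod.
apply: eq_mod_trans3 (eq_mod_repr A) (eq_mod_repr B) => w /=.
have := EM (val A w); have := EM (val (repr (\pi_balg A)) w).
by have := EM (val B w); have := EM (val (repr (\pi_balg B)) w); tauto.
Qed.

Lemma pi_balgC : {morph \pi_balg : A / algC A >-> balgC A}.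
Proof.
move=> A; unlock balgC; apply/esym/pi_eq_mod.
apply: eq_mod_trans3 (eq_mod_repr A) (eq_mod_repr A) => w /=.
by have := EM (val A w); have := EM (val (repr (\pi_balg A)) w); tauto.
Qed.

Definition balg_le (a b : balg) : bool := balgI a b == a.
Definition balg_lt (a b : balg) : bool := (b != a) && balg_le a b.

Lemma alg_eq (A B : alg) : val A = val B -> A = B.
Proof. exact: val_inj. Qed.

Ltac by_rep :=
  repeat (let a := fresh "a" in move=> a; rewrite -[a]reprK; move: (repr a) => {}a);
  rewrite -?(pi_balgI, pi_balgU); congr (\pi_balg _); apply: alg_eq => /=.

Lemma balgIC : commutative balgI. Proof. by by_rep; rewrite setIC. Qed.
Lemma balgUC : commutative balgU. Proof. by by_rep; rewrite setUC. Qed.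
Lemma balgIA : associative balgI. Proof. by by_rep; rewrite setIA. Qed.
Lemma balgUA : associative balgU. Proof. by by_rep; rewrite setUA. Qed.
Lemma balgUKI : forall b a, balgI a (balgU a b) = a.
Proof. by by_rep; rewrite setUC setKU. Qed.
Lemma balgIKU : forall b a, balgU a (balgI a b) = a.
Proof. by by_rep; rewrite setIC setKI. Qed.
Lemma balgIUl : left_distributive balgI balgU.
Proof. by by_rep; rewrite setIUl. Qed.
Lemma balgII : idempotent_op balgI. Proof. by by_rep; rewrite setIid. Qed.

Lemma balg_le_def a b : balg_le a b = (balgI a b == a). Proof. by []. Qed.
Lemma balg_lt_def a b : balg_lt a b = (b != a) && balg_le a b. Proof. by []. Qed.

Fact balg_display : Order.disp_t. Proof. exact: Order.Disp tt tt. Qed.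

HB.instance Definition _ := Order.isMeetJoinDistrLattice.Build balg_display balg
  balg_le_def balg_lt_def balgIC balgUC balgIA balgUA balgUKI balgIKU balgIUl balgII.

Lemma balg_bot_le (a : balg) : (\pi_balg alg0 <= a :> balg)%O.
Proof.
rewrite leEmeet; apply/eqP; rewrite -[a]reprK -[Order.meet _ _]/(balgI _ _).
by rewrite -pi_balgI; congr (\pi_balg _); apply: alg_eq => /=; rewrite set0I.
Qed.
Lemma balg_le_top (a : balg) : (a <= \pi_balg algT :> balg)%O.
Proof.
rewrite leEmeet; apply/eqP; rewrite -[a]reprK -[Order.meet _ _]/(balgI _ _).
by rewrite -pi_balgI; congr (\pi_balg _); apply: alg_eq => /=; rewrite setIT.
Qed.
HB.instance Definition _ := Order.hasBottom.Build balg_display balg balg_bot_le.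
HB.instance Definition _ := Order.hasTop.Build balg_display balg balg_le_top.

Lemma balgUCr (a : balg) : Order.join a (balgC a) = \top%O.
Proof.
rewrite -[a]reprK -[Order.join _ _]/(balgU _ _) -pi_balgC -pi_balgU.
by congr (\pi_balg _); apply: alg_eq => /=; rewrite setUv.
Qed.
Lemma balgICr (a : balg) : Order.meet a (balgC a) = \bot%O.
Proof.
rewrite -[a]reprK -[Order.meet _ _]/(balgI _ _) -pi_balgC -pi_balgI.
by congr (\pi_balg _); apply: alg_eq => /=; rewrite setICr.
Qed.
HB.instance Definition _ :=
  Order.TBDistrLattice_hasComplement.Build balg_display balg balgUCr balgICr.

Definition cls (X : set (ext g)) (h : coded X) : balg := \pi_balg (Alg h).

End CodedSets.

(** The least upper bound and the greatest lower bound of a subset of the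
    algebra, [\bot] if there is none.  Under [aleph1_saturated M] the algebra is
    complete and the default is not used. *)

Definition bsup (M : trueModel) (g : M) (S : set (balg g)) : balg g :=
  xget \bot%O (supremums S).
Definition binf (M : trueModel) (g : M) (S : set (balg g)) : balg g :=
  xget \bot%O (infimums S).

Definition graph (k : nat) : Type :=
  {e : {set 'I_k * 'I_k} | [forall i, (i, i) \notin e] &&
                           [forall i, forall j, ((i, j) \in e) == ((j, i) \in e)]}.
HB.instance Definition _ k := Finite.on (graph k).

Inductive gform : nat -> Type :=
| GEq m of 'I_m & 'I_m : gform m
| GEdge m of 'I_m & 'I_m : gform m
| GNot m of gform m : gform m
| GAnd m of gform m & gform m : gform m
| GOr m of gform m & gform m : gform m
| GEx m of gform m.+1 : gform m
| GAll m of gform m.+1 : gform m.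

Fixpoint gopen m (phi : gform m) : bool :=
  match phi with
  | GEq _ _ _ | GEdge _ _ _ => true
  | GNot _ p => gopen p
  | GAnd _ p q | GOr _ p q => gopen p && gopen q
  | GEx _ _ | GAll _ _ => false
  end.

(** [(forall x_0) ... (forall x_(l-1)) phi] *)
Fixpoint gclosure l : gform l -> gform 0 :=
  match l return gform l -> gform 0 with
  | 0 => fun phi => phi
  | l'.+1 => fun phi => gclosure (GAll phi)
  end.

Fixpoint gsat k (w : graph k) m (phi : gform m) : ('I_m -> 'I_k) -> Prop :=
  match phi with
  | GEq _ i j => fun v => v i = v j
  | GEdge _ i j => fun v => (v i, v j) \in val w
  | GNot _ p => fun v => ~ gsat w p v
  | GAnd _ p q => fun v => gsat w p v /\ gsat w q v
  | GOr _ p q => fun v => gsat w p v \/ gsat w q v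
  | GEx _ p => fun v => exists x : 'I_k, gsat w p (snoc v x)
  | GAll _ p => fun v => forall x : 'I_k, gsat w p (snoc v x)
  end.

(** The probability that a uniformly random member of [A] satisfies [phi]. *)
Definition Pr_sat (R : realType) k (A : {set graph k}) (phi : gform 0) : R :=
  (#|[set w in A | `[< gsat w phi noassign >]]|%:R / #|A|%:R)%R.

(** Wide sequences start at [k = 1]; the value at [k = 0] plays no role. *)
Definition wide (G : forall k : nat, {set graph k}) : Prop :=
  (fun k => #|G k|) @ \oo --> \oo.

(** A graph is coded by its set of (coded) edges. *)
Definition graph_code k (w : graph k) : nat :=
  encode [fset npair (val p.1) (val p.2) | p in val w]%fset.

Definition seq_code (G : forall k : nat, {set graph k}) (k : nat) : nat :=
  encode [fset graph_code w | w in G k]%fset.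

(** The code of the value of the sequence at the index [n]: the sample space is
    [ext (value_at G n)], with edge relations [Medge w]. *)
Definition value_at (M : Lstructure) (G : forall k : nat, {set graph k}) (n : M) : M :=
  fun1 (seq_code G) n.

Record rv_family (M : Lstructure) (g : M) := {
  rv_set : set (ext g -> M);
  rv_coded : forall alpha, rv_set alpha -> coded_fun alpha
}.

Record vertex (M : Lstructure) (n g : M) (F : rv_family g) := {
  vfun :> ext g -> M;
  vertex_rv : rv_set F vfun;
  vertex_lt : forall w, Mlt (vfun w) n
}.

Section WideLimit.
Variables (M : trueModel) (n g : M) (F : rv_family g).
Implicit Types alpha beta : vertex n F.

Definition tv_eq alpha beta : balg g :=
  cls (coded_eq (rv_coded (vertex_rv alpha)) (rv_coded (vertex_rv beta))).

Definition tv_edge alpha beta : balg g :=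
  cls (coded_edge (rv_coded (vertex_rv alpha)) (rv_coded (vertex_rv beta))).

Fixpoint tv m (phi : gform m) : ('I_m -> vertex n F) -> balg g :=
  match phi with
  | GEq _ i j => fun v => tv_eq (v i) (v j)
  | GEdge _ i j => fun v => tv_edge (v i) (v j)
  | GNot _ p => fun v => (~` tv p v)%O
  | GAnd _ p q => fun v => (tv p v `&` tv q v)%O
  | GOr _ p q => fun v => (tv p v `|` tv q v)%O
  | GEx _ p => fun v => bsup (range (fun alpha => tv p (snoc v alpha)))
  | GAll _ p => fun v => binf (range (fun alpha => tv p (snoc v alpha)))
  end.

End WideLimit.

(* Main.v *)
Require Import Defs.
From mathcomp Require Import all_boot all_order all_algebra.
From mathcomp Require Import finmap.
From mathcomp Require Import all_classical all_reals all_analysis.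

(** Call a graph in [G k] failing if the universal sentence [(forall x) phi] is
    false in it.  The hypothesis on probabilities says that for every standard
    [K] the failing graphs make up less than a [1 / K] fraction of [G k] as soon
    as [k >= k0(K)] and [G k] is nonempty ([failing_few]).  A nonstandard [n] is
    above every standard [k0], so this passes by transfer to the index [n]: the
    value at [n] of the sequence of failing sets is infinitesimal relative to
    the sample space ([failing_infinitesimal]).

    For an open [phi] no supremum or infimum is involved, so its truth value at
    vertices [alpha_i] is the class of the event that [phi] holds in the sampled
    graph at the points [alpha_i(omega)] ([tv_open]).  Transfer also says that
    outside the failing set [phi] holds at all points below [n]
    ([bounded_sat_not_failing]), in particular at the values of the [alpha_i].
    So the complement of the event is negligible and every instance of [phi] has
    truth value [\top]; the universal closure is an infimum of such values.

    This second use of transfer needs satisfaction in a graph to be expressed in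
    [L_all].  Hence [bounded_sat], which reads a graph formula in any
    [L_all]-structure with the quantifiers bounded by the number of vertices: on
    [nat] it is satisfaction in the coded graph ([bounded_satN]), and it is
    defined by an [L_all]-formula ([Lsat_Lform_of]). *)

Set Implicit Arguments.
Unset Strict Implicit.
Unset Printing Implicit Defensive.

Import Order.TTheory GRing.Theory Num.Theory.
Import numFieldNormedType.Exports.
Local Open Scope classical_set_scope.

(** * Graph formulas read in L_all *)

#[local] Arguments Leval : simpl never.
#[local] Arguments Lsat : simpl never.

Fixpoint bounded_sat (M : Lstructure) (w n : M) m (phi : gform m) :
    ('I_m -> M) -> Prop :=
  match phi with
  | GEq _ i j => fun v => v i = v j
  | GEdge _ i j => fun v => Medge w (v i) (v j)
  | GNot _ p => fun v => ~ bounded_sat w n p v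
  | GAnd _ p q => fun v => bounded_sat w n p v /\ bounded_sat w n q v
  | GOr _ p q => fun v => bounded_sat w n p v \/ bounded_sat w n q v
  | GEx _ p => fun v => exists x : M, Mlt x n /\ bounded_sat w n p (snoc v x)
  | GAll _ p => fun v => forall x : M, Mlt x n -> bounded_sat w n p (snoc v x)
  end.

(** The assignment [s] of variables to variables, together with the variables
    [W] and [N] standing for the graph and its size, makes room for these two
    parameters without index arithmetic: going under a quantifier shifts all the
    old variables and sends the bound one to the new last variable. *)
Fixpoint Lform_of m (phi : gform m) p (W N : 'I_p) :
    ('I_m -> 'I_p) -> Lform p :=
  match phi with
  | GEq _ i j => fun s => LEq (LVar (s i)) (LVar (s j))
  | GEdge _ i j => fun s =>
      R2 nmem (T2 npair (LVar (s i)) (LVar (s j))) (LVar W)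
  | GNot _ q => fun s => LNot (Lform_of q W N s)
  | GAnd _ q r => fun s => LAnd (Lform_of q W N s) (Lform_of r W N s)
  | GOr _ q r => fun s => LOr (Lform_of q W N s) (Lform_of r W N s)
  | GEx _ q => fun s =>
      LEx (LAnd (R2 nlt (LVar ord_max) (LVar (lift ord_max N)))
        (Lform_of q (lift ord_max W) (lift ord_max N)
           (snoc (fun i => lift ord_max (s i)) ord_max)))
  | GAll _ q => fun s =>
      LAll (LImp (R2 nlt (LVar ord_max) (LVar (lift ord_max N)))
        (Lform_of q (lift ord_max W) (lift ord_max N)
           (snoc (fun i => lift ord_max (s i)) ord_max)))
  end.

Lemma snoc_lift (T : Type) m (v : 'I_m -> T) x i :
  snoc v x (lift ord_max i) = v i.
Proof. by rewrite /snoc liftK. Qed.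

Lemma snoc_max (T : Type) m (v : 'I_m -> T) x : snoc v x ord_max = x.
Proof. by rewrite /snoc unlift_none. Qed.

Lemma snoc_map (T U : Type) (f : T -> U) m (v : 'I_m -> T) x :
  (fun i => f (snoc v x i)) = snoc (fun i => f (v i)) (f x).
Proof. by apply/funext => i; rewrite /snoc; case: unliftP. Qed.

Lemma ExE (M : Lstructure) m (p : Lform m.+1) (v : 'I_m -> M) :
  Lsat (LEx p) v = exists x, Lsat p (snoc v x).
Proof. by []. Qed.

Lemma AllE (M : Lstructure) m (p : Lform m.+1) (v : 'I_m -> M) :
  Lsat (LAll p) v = forall x, Lsat p (snoc v x).
Proof. by []. Qed.

Lemma Lsat_Lform_of (M : Lstructure) m (phi : gform m) p (W N : 'I_p) s
    (v : 'I_p -> M) :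
  Lsat (Lform_of phi W N s) v <->
  bounded_sat (v W) (v N) phi (fun i => v (s i)).
Proof.
elim: phi p W N s v => {m} [m i j|m i j|m q IH|m q IHq r IHr|m q IHq r IHr
  |m q IH|m q IH] p W N s v; rewrite /= ?LE ?IH ?IHq ?IHr //.
- rewrite ExE; split=> -[x h]; exists x; move: h;
  by rewrite AndE R2E IH !VarE !snoc_lift snoc_max snoc_map snoc_max
    (funext (fun i => snoc_lift v x (s i))).
- rewrite AllE; split=> + x => /(_ x);
  by rewrite ImpE R2E IH !VarE !snoc_lift snoc_max snoc_map snoc_max
    (funext (fun i => snoc_lift v x (s i))).
Qed.

Lemma Lsat_Lform_of_sentence (M : Lstructure) (psi : gform 0) p (W N : 'I_p)
    (v : 'I_p -> M) :
  Lsat (Lform_of psi W N noassign) v <-> bounded_sat (v W) (v N) psi noassign.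
Proof. by rewrite Lsat_Lform_of -(noassignE (fun i => v (noassign i))). Qed.

(** The bounds built into the quantifiers put exactly the points below [n] in
    reach, which is where the values of the vertices lie. *)
Lemma bounded_sat_closure (M : Lstructure) (w n : M) l (phi : gform l) :
  bounded_sat w n (gclosure phi) noassign ->
  forall v, (forall i, Mlt (v i) n) -> bounded_sat w n phi v.
Proof.
elim: l phi => [|l IH] phi /=; first by move=> h v _; rewrite (noassignE v).
move=> /IH/= h v vn; rewrite -(snocK v).
by apply: h => [i|]; apply: vn.
Qed.

(** * Codes of graphs *)

Lemma mem_graph_code k (w : graph k) (i j : 'I_k) :
  nmem (npair i j) (graph_code w) <-> (i, j) \in val w.
Proof.
rewrite /nmem /graph_code encodeK; split=> [/imfsetP[[i' j'] /= h e]|h].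
  by move: e => /(pcan_inj choice.pickleK)[/val_inj -> /val_inj ->].
by apply/imfsetP; exists (i, j).
Qed.

(** Injectivity makes counting codes the same as counting graphs, so that
    probabilities are not distorted by the coding. *)
Lemma graph_code_inj k : injective (@graph_code k).
Proof.
move=> w w' e; apply/val_inj/setP => -[i j].
by apply/idP/idP => /mem_graph_code; [rewrite e|rewrite -e] => /mem_graph_code.
Qed.

Lemma bounded_satN k (w : graph k) m (phi : gform m) (v : 'I_m -> 'I_k) :
  bounded_sat (M := NN) (graph_code w) k phi (fun i => val (v i)) <->
  gsat w phi v.
Proof.
elim: phi v => {m} [m i j|m i j|m q IH|m q IHq r IHr|m q IHq r IHr
  |m q IH|m q IH] v /=.
- by split=> [/val_inj|->].
- exact: mem_graph_code.
- by rewrite IH.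
- by rewrite IHq IHr.
- by rewrite IHq IHr.
- split=> [[x [xk]]|[x]].
    by rewrite -[x]/(val (Ordinal xk)) -snoc_map IH; exists (Ordinal xk).
  by rewrite -IH snoc_map => h; exists x; split=> //; exact: (ltn_ord x).
- split=> [h x|h x xk].
    by rewrite -IH snoc_map; apply: h; exact: (ltn_ord x).
  by rewrite -[x]/(val (Ordinal xk)) -snoc_map IH.
Qed.

Lemma bounded_satN_sentence k (w : graph k) (psi : gform 0) :
  bounded_sat (M := NN) (graph_code w) k psi noassign <-> gsat w psi noassign.
Proof.
by rewrite -bounded_satN -(noassignE (fun i => val (noassign (T := 'I_k) i))).
Qed.

Lemma ncard_seq_code (G : forall k, {set graph k}) k :
  ncard (seq_code G k) = #|G k|.
Proof.
rewrite /ncard /seq_code encodeK card_imfset ?cardE //=; exact: graph_code_inj.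
Qed.

(** * The graphs in which a sentence fails *)

Definition failing (G : forall k, {set graph k}) (psi : gform 0) k :
    {set graph k} :=
  [set w in G k | ~~ `[< gsat w psi noassign >]].

(** Where [G k] is nonempty, [1 - Pr_sat] is the fraction of failing graphs, and
    the limit puts it below [1 / K]. *)
Lemma failing_few (R : realType) (G : forall k, {set graph k}) (psi : gform 0)
    K :
  (fun k => Pr_sat R (G k) psi) @ \oo --> (1%R : R) -> (0 < K)%N ->
  exists k0, forall k, (k0 <= k)%N -> (0 < #|G k|)%N ->
    (K * #|failing G psi k| < #|G k|)%N.
Proof.
move=> hlim K0.
have KV : (0 < K%:R^-1 :> R)%R by rewrite invr_gt0 ltr0n.
have /cvgrPdist_lt/(_ _ KV)[k0 _ hk0] := hlim.
exists k0 => k /hk0/= hk Gk; move: hk.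
have gR : (0 < #|G k|%:R :> R)%R by rewrite ltr0n.
set good := [set w in G k | `[< gsat w psi noassign >]].
have cardG : #|G k| = (#|good| + #|failing G psi k|)%N.
  rewrite -(cardsID [set w | `[< gsat w psi noassign >]] (G k)).
  by congr (_ + _)%N; apply: eq_card => w; rewrite !inE // andbC.
have -> : (1 - Pr_sat R (G k) psi = #|failing G psi k|%:R / #|G k|%:R)%R.
  rewrite /Pr_sat -/good -[X in (X - _)%R](divff (lt0r_neq0 gR)) -mulrBl.
  by rewrite {1}cardG natrD addrC addKr.
rewrite ger0_norm ?divr_ge0// ltr_pdivrMr// -(ltr_pM2l (x := K%:R)%R) ?ltr0n//.
by rewrite mulVKf ?pnatr_eq0 -?lt0n// -natrM ltr_nat.
Qed.

(** * Transfer *)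

Lemma transfer_at (M : trueModel) m (phi : Lform m) (v : 'I_m -> M) :
  (forall u, Lsat (M := NN) phi u) -> Lsat (M := M) phi v.
Proof. by move=> h; apply: transfer. Qed.

Section Nonstandard.
Variables (M : trueModel) (n : M).
Hypothesis n_nonstandard : forall c : nat, n <> std M c.

(** A number below [c.+1] is below [c] or equal to [c], so by induction the only
    numbers below a standard one are standard. *)
Lemma nonstandard_large c : ~ Mlt n (std M c).
Proof.
elim: c => [|c IH] h.
  have := @transfer_at M 1 (LNot (R2 nlt (LVar ord0) (T0 _ 0))) (fun=> n).
  by rewrite !LE; apply=> // u; rewrite !LE.
have := @transfer_at M 1 (LImp (R2 nlt (LVar ord0) (T0 _ c.+1))
  (LOr (R2 nlt (LVar ord0) (T0 _ c)) (LEq (LVar ord0) (T0 _ c)))) (fun=> n).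
rewrite !LE; case=> //; last by move=> /n_nonstandard.
move=> u; rewrite !LE !NNE /nlt ltnS leq_eqVlt.
by case/orP => [/eqP|]; [right|left].
Qed.

(** The threshold [k0] of each instance is a standard number, and [n] is above
    all of them at once. *)
Lemma infinitesimal_at (a b : nat -> nat) :
  (forall K, (0 < K)%N -> exists k0, forall k, (k0 <= k)%N -> (0 < b k)%N ->
     (K * a k < b k)%N) ->
  infinitesimal (Defs.fun1 a n) (Defs.fun1 b n).
Proof.
move=> small K K0; have [k0 hk0] := small K K0.
have := @transfer_at M 1 (LOr (R2 nlt (LVar ord0) (T0 _ k0))
  (LImp (R2 nlt (T0 _ 0) (T1 b (LVar ord0)))
    (R2 nlt (T2 muln (T0 _ K) (T1 a (LVar ord0))) (T1 b (LVar ord0)))))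
  (fun=> n).
rewrite !LE; case=> //; last by move=> /nonstandard_large.
move=> u; rewrite !LE !NNE /nlt.
by have [|/hk0] := ltnP (u ord0) k0; [left|right].
Qed.

Lemma McardE (f : nat -> nat) :
  Mcard (Defs.fun1 (M := M) f n) = Defs.fun1 (ncard \o f) n.
Proof.
have := @transfer_at M 1 (LEq (T1 ncard (T1 f (LVar ord0)))
  (T1 (ncard \o f) (LVar ord0))) (fun=> n).
by rewrite !LE; apply=> u; rewrite !LE.
Qed.

Variables (R : realType) (G : forall k, {set graph k}) (psi : gform 0).

Lemma failing_infinitesimal :
  (fun k => Pr_sat R (G k) psi) @ \oo --> (1%R : R) ->
  infinitesimal (Mcard (value_at (failing G psi) n)) (Mcard (value_at G n)).
Proof.
move=> hlim; rewrite !McardE; apply: infinitesimal_at => K K0.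
have [k0 hk0] := failing_few hlim K0.
by exists k0 => k /hk0 /=; rewrite !ncard_seq_code.
Qed.

(** The transferred statement about [nat] holds because every member of
    [seq_code G k] is the code of some graph of [G k]. *)
Lemma bounded_sat_not_failing (w : M) :
  Mmem w (value_at G n) -> ~ Mmem w (value_at (failing G psi) n) ->
  bounded_sat w n psi noassign.
Proof.
have := @transfer_at M 2
  (LImp (R2 nmem (LVar ord0) (T1 (seq_code G) (LVar ord_max)))
    (LImp (LNot (R2 nmem (LVar ord0)
                   (T1 (seq_code (failing G psi)) (LVar ord_max))))
      (Lform_of psi ord0 ord_max noassign)))
  (Defs.row w [:: n]).
rewrite !LE Lsat_Lform_of_sentence; apply=> u.
rewrite !LE Lsat_Lform_of_sentence !NNE.
rewrite /nmem /seq_code !encodeK => /imfsetP[w' /= Gw' ->] good.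
apply/bounded_satN_sentence.
apply: contrapT => bad; apply: good; apply/imfsetP; exists w' => //=.
by rewrite inE Gw'; apply/asboolPn.
Qed.

End Nonstandard.

(** * Truth values *)

Section TruthValues.
Variables (M : trueModel) (n g : M) (F : rv_family g).

Lemma cls_eq_top (X : set (ext g)) (h : coded X) :
  Defs.negligible (~` X) -> cls h = (\top)%O.
Proof.
move=> nX; apply: pi_eq_mod; apply/asboolP.
by rewrite /= setYTC.
Qed.

(** The quotient map commutes with the Boolean operations, so the class of the
    event can be followed through the connectives. *)
Lemma tv_open m (phi : gform m) (v : 'I_m -> vertex n F) : gopen phi ->
  exists h : coded [set w | bounded_sat (val w) n phi (fun i => v i w)],
    tv phi v = cls h.
Proof.
elim: phi v => {m} [m i j|m i j|m q IH|m q IHq r IHr|m q IHq r IHr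
  |m q IH|m q IH] v //=.
- by move=> _; eexists; reflexivity.
- by move=> _; eexists; reflexivity.
- move=> /(IH v)[h ->]; exists (codedC h).
  rewrite -[(~` _)%O]/(balgC _) /cls -pi_balgC.
  by congr (\pi_(balg g) _)%qT; apply: alg_eq.
- move=> /andP[/(IHq v)[hq ->] /(IHr v)[hr ->]]; exists (codedI hq hr).
  rewrite -[(_ `&` _)%O]/(balgI _ _) /cls -pi_balgI.
  by congr (\pi_(balg g) _)%qT; apply: alg_eq.
- move=> /andP[/(IHq v)[hq ->] /(IHr v)[hr ->]]; exists (codedU hq hr).
  rewrite -[(_ `|` _)%O]/(balgU _ _) /cls -pi_balgU.
  by congr (\pi_(balg g) _)%qT; apply: alg_eq.
Qed.

(** [S] may be empty, as there may be no vertices at all: the infimum of the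
    empty set is [\top] too. *)
Lemma binf_top (S : set (balg g)) : (forall a, S a -> a = \top%O) ->
  binf S = \top%O.
Proof.
move=> ST; apply: xget_subset1; last exact: is_subset1_infimums.
by split=> [a /ST ->|a _]; rewrite ?lex1.
Qed.

Lemma tv_closure_top l (phi : gform l) :
  (forall v : 'I_l -> vertex n F, tv phi v = \top%O) ->
  tv (n := n) (F := F) (gclosure phi) noassign = \top%O.
Proof.
elim: l phi => [|l IH] phi h /=; first exact: h.
by apply: IH => v /=; apply: binf_top => _ [alpha _ <-].
Qed.

End TruthValues.

Theorem theorem3p9 (R : realType) (M : trueModel)
    (hsat : aleph1_saturated M)
    (n : M) (hn : forall c : nat, n <> std M c)
    (G : forall k : nat, {set graph k}) (hG : wide G)
    (F : rv_family (value_at G n))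
    (l : nat) (phi : gform l) (hphi : gopen phi)
    (hlim : (fun k : nat => Pr_sat R (G k) (gclosure phi)) @ \oo --> (1%R : R)) :
  tv (n := n) (F := F) (gclosure phi) noassign = (\top)%O.
Proof.
apply: tv_closure_top => v; have [h ->] := tv_open v hphi.
apply: cls_eq_top; have [c cX] := codedC h; exists c => //.
(* A sample at which [phi] fails at the values of [v] is a failing graph. *)
apply: infinitesimal_sub (failing_infinitesimal hn hlim).
rewrite -cX => _ [w Xw <-]; apply: contrapT => wgood; apply: Xw => /=.
apply: bounded_sat_closure => [|i]; last exact: vertex_lt.
exact: bounded_sat_not_failing (set_valP w) wgood.
Qed.
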